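(* Let $N$ be the place-transition net with places $p_1,\dots,p_8$ and transitions $t_1,\dots,t_6$, whose arcs (all of multiplicity $1$ unless stated otherwise) are: $t_1$: input $p_1$; output $p_5$ with multiplicity $2$. $t_2$: inputs $p_4, p_5$; output $p_6$. $t_3$: inputs $p_4, p_5, p_8$; outputs $p_7, p_8$. $t_4$: input $p_6$ with multiplicity $2$; outputs $p_2$ and $p_4$ with multiplicity $2$. $t_5$: inputs $p_5, p_6$; outputs $p_3, p_4$. $t_6$: inputs $p_5, p_7$; outputs $p_3, p_4$. Let $x \geq 1$ be an integer and consider the initial marking $\{p_1, x\cdot p_4, p_8\}$ (one token in $p_1$, $x$ tokens in $p_4$, one token in $p_8$, no other tokens). Run $N$ as a strong Sleptsov net. Then every run of the net from this initial marking terminates (reaches a marking in which no transition is firable), and the terminal marking is $\{p_2, x\cdot p_4, p_8\}$ if $x>1$, and $\{p_3, x\cdot p_4, p_8\}$ if $x=1$. Thus, if a register with nonnegative integer value $v$ is stored in place $p_4$ as the marking $x=v+1$, the net, started by a token in $p_1$, puts a token into $p_3$ exactly when $v=0$ and into $p_2$ exactly when $v>0$, leaving the register unchanged.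
   Context: A place-transition net is $N=(P,T,A,\mu_0)$ with finite place set $P$, finite transition set $T$, arc multiplicities $A: P\times T \cup T\times P \to \mathbb{Z}_{\geq 0}$ (writing $a(p,t)$, $a(t,p)$), and markings $\mu: P\to\mathbb{Z}_{\geq 0}$, $\mu_0$ initial. The firability multiplicity of transition $t$ in marking $\mu$ is $c(t)=\min_{p: a(p,t)>0} \lfloor \mu(p)/a(p,t)\rfloor$; $t$ is firable if $c(t)>0$. In a strong Sleptsov net, at each step one firable transition $t$ whose $c(t)$ is maximal among all transitions is chosen (nondeterministically if several have the same maximal value) and fires $c(t)$ times at once: $\mu'(p)=\mu(p)-c(t)\,a(p,t)+c(t)\,a(t,p)$ for all $p\in P$. The net of the claim is the paper's zero-check net given in a figure; its arcs are as reconstructed from the firing sequences described in the paper's proof. *)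

(* Defs.v *)
From HB Require Import structures.
From mathcomp Require Import all_boot.

Set Implicit Arguments.
Unset Strict Implicit.
Unset Printing Implicit Defensive.

Record ptnet (P T : finType) : Type := PTNet {
  pre : P -> T -> nat;
  post : T -> P -> nat;
  init : {ffun P -> nat}
}.

Section StrongSleptsov.

Variables (P T : finType) (N : ptnet P T).
Implicit Types (mu : {ffun P -> nat}) (t : T).

(* The minimum of mu(p) %/ a(p,t) over the input places p of t. The seed of   *)
(* the iterated minn is itself one of the values, so it does not affect the   *)
(* result. The minimum is undefined when t has no input place; such a t gets  *)
(* the junk value 0.                                                          *)
Definition fire_mult mu t : nat :=
  if [pick p | 0 < pre N p t] is Some p0 then
    \big[minn/mu p0 %/ pre N p0 t]_(p | 0 < pre N p t) (mu p %/ pre N p t)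
  else 0.

Definition firable mu t : bool := 0 < fire_mult mu t.

(* The truncated subtraction is exact: fire_mult mu t * pre N p t <= mu p.    *)
Definition fire mu t : {ffun P -> nat} :=
  [ffun p => mu p - fire_mult mu t * pre N p t + fire_mult mu t * post N t p].

Definition sstep : rel {ffun P -> nat} := fun mu mu' =>
  [exists t, [&& firable mu t,
                 [forall u, fire_mult mu u <= fire_mult mu t]
               & mu' == fire mu t]].

Definition terminal mu : bool := [forall t, ~~ firable mu t].

(* A finite run is given by the markings that follow the initial one. *)
Definition finite_run (s : seq {ffun P -> nat}) : bool := path sstep (init N) s.

Definition final_marking (s : seq {ffun P -> nat}) : {ffun P -> nat} :=
  last (init N) s.

Definition maximal_run (s : seq {ffun P -> nat}) : Prop :=
  finite_run s /\ forall mu, ~~ sstep (final_marking s) mu.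

Definition infinite_run (r : nat -> {ffun P -> nat}) : Prop :=
  r 0 = init N /\ forall n, sstep (r n) (r n.+1).

(* There is no infinite run, and every run that cannot be continued has       *)
(* reached a marking in which no transition is firable.                       *)
Definition every_run_terminates : Prop :=
  (~ exists r, infinite_run r) /\
  (forall s, maximal_run s -> terminal (final_marking s)).

End StrongSleptsov.

Inductive place := p1 | p2 | p3 | p4 | p5 | p6 | p7 | p8.

Definition place_ord (p : place) : 'I_8 :=
  match p with
  | p1 => @Ordinal 8 0 isT | p2 => @Ordinal 8 1 isT
  | p3 => @Ordinal 8 2 isT | p4 => @Ordinal 8 3 isT
  | p5 => @Ordinal 8 4 isT | p6 => @Ordinal 8 5 isT
  | p7 => @Ordinal 8 6 isT | p8 => @Ordinal 8 7 isT
  end.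

Definition ord_place (i : 'I_8) : place :=
  nth p1 [:: p1; p2; p3; p4; p5; p6; p7; p8] i.

Lemma place_ordK : cancel place_ord ord_place. Proof. by case. Qed.

HB.instance Definition _ := Finite.copy place (can_type place_ordK).

Inductive trans := t1 | t2 | t3 | t4 | t5 | t6.

Definition trans_ord (t : trans) : 'I_6 :=
  match t with
  | t1 => @Ordinal 6 0 isT | t2 => @Ordinal 6 1 isT
  | t3 => @Ordinal 6 2 isT | t4 => @Ordinal 6 3 isT
  | t5 => @Ordinal 6 4 isT | t6 => @Ordinal 6 5 isT
  end.

Definition ord_trans (i : 'I_6) : trans :=
  nth t1 [:: t1; t2; t3; t4; t5; t6] i.

Lemma trans_ordK : cancel trans_ord ord_trans. Proof. by case. Qed.

HB.instance Definition _ := Finite.copy trans (can_type trans_ordK).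

Definition zc_pre (p : place) (t : trans) : nat :=
  match t, p with
  | t1, p1 => 1
  | t2, (p4 | p5) => 1
  | t3, (p4 | p5 | p8) => 1
  | t4, p6 => 2
  | t5, (p5 | p6) => 1
  | t6, (p5 | p7) => 1
  | _, _ => 0
  end.

Definition zc_post (t : trans) (p : place) : nat :=
  match t, p with
  | t1, p5 => 2
  | t2, p6 => 1
  | t3, (p7 | p8) => 1
  | t4, p2 => 1
  | t4, p4 => 2
  | t5, (p3 | p4) => 1
  | t6, (p3 | p4) => 1
  | _, _ => 0
  end.

(* The marking {q, x.p4, p8}, for q other than p4 and p8. *)
Definition zc_marking (q : place) (x : nat) : {ffun place -> nat} :=
  [ffun p => if p == q then 1
             else match p with p4 => x | p8 => 1 | _ => 0 end].

Definition zero_check (x : nat) : ptnet place trans :=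
  PTNet zc_pre zc_post (zc_marking p1 x).

(* Main.v *)
Require Import Defs.
From mathcomp Require Import all_boot.
From mathcomp Require Import zify.

Set Implicit Arguments.
Unset Strict Implicit.
Unset Printing Implicit Defensive.

(** The token of [p1] becomes two tokens in [p5].  If [x > 1], then [t2] has
    multiplicity 2 while [t3] is held to 1 by the single token of [p8], so [t2]
    takes both tokens at once, and [t4] restores [p4] and marks [p2].  If
    [x = 1], then [t2] and [t3] tie with multiplicity 1; either one leaves one
    token in [p5] and one in [p6] or [p7], and then [t5] or [t6], respectively,
    restores [p4] and marks [p3]. *)

Section Runs.

Variables (P T : finType) (N : ptnet P T).
Implicit Types (mu nu : {ffun P -> nat}) (t : T).

(** Lower bounds determine the multiplicity, and they trade the minimum of quotients for linear
    inequalities. At a place with no arc into [t] the inequality reads [0 <= mu p], so all places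
    may be quantified over. *)
Lemma leq_fire_mult mu t k : (exists p, 0 < pre N p t) ->
  (k <= fire_mult N mu t) = [forall p, k * pre N p t <= mu p].
Proof.
move=> [q q_in]; rewrite /fire_mult; case: pickP => [p0 p0_in|/(_ q)]; last first.
  by rewrite q_in.
have divE p : 0 < pre N p t -> (k <= mu p %/ pre N p t) = (k * pre N p t <= mu p).
  by move=> p_in; rewrite leq_divRL.
apply/idP/forallP => [le_k p|le_k].
  have [p_in|] := ltnP 0 (pre N p t); last by rewrite leqn0 => /eqP->; rewrite muln0.
  rewrite -divE // (leq_trans le_k) //.
  (* [minn] has no neutral element on [nat], so the term of [p] is not split off; the bound comes by
     induction on the enumeration. *)
  elim: (index_enum P) (mem_index_enum p) => // q' r IHr.
  rewrite inE big_cons => /predU1P[<-|/IHr le_r]; first by rewrite p_in geq_minl.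
  by case: ifP => _ //; apply: leq_trans (geq_minr _ _) le_r.
elim/big_ind: _ => [|a b le_ka le_kb|p p_in]; rewrite ?divE //.
by rewrite leq_min le_ka.
Qed.

Lemma fire_eq mu t k nu : fire_mult N mu t = k ->
  (forall p, mu p - k * pre N p t + k * post N t p = nu p) -> fire N mu t = nu.
Proof. by move=> <- eq_nu; apply/ffunP => p; rewrite ffunE eq_nu. Qed.

Lemma sstepP mu mu' :
  reflect (exists t, [/\ firable N mu t,
                         forall u, fire_mult N mu u <= fire_mult N mu t
                       & mu' = fire N mu t])
          (sstep N mu mu').
Proof.
apply: (iffP existsP) => -[t].
  by case/and3P=> ft /forallP max_t /eqP ->; exists t.
by case=> ft max_t ->; exists t; rewrite ft eqxx andbT; apply/forallP.
Qed.

Lemma terminal_sstep mu mu' : terminal N mu -> ~~ sstep N mu mu'.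
Proof. by move=> /forallP tm; apply/sstepP => -[t [ft _ _]]; move: (tm t); rewrite ft. Qed.

(** The maximality rule never blocks the net: [T] is finite, so if some [t] is firable, a transition
    of maximal multiplicity exists and is firable too. *)
Lemma stuck_terminal mu : (forall mu', ~~ sstep N mu mu') -> terminal N mu.
Proof.
move=> stuck; apply/forallP => t; apply/negP => ft.
case: (@arg_maxnP _ t xpredT (fire_mult N mu) isT) => u _ max_u.
move/negP: (stuck (fire N mu u)); apply; apply/sstepP; exists u.
by split=> // [|v]; [apply: leq_trans (max_u t _) | exact: max_u].
Qed.

(** The well-founded tree of all runs, with every leaf equal to [nu]; induction on it gives both
    termination and the final marking. Without [~~ terminal N mu], a stuck marking would satisfy the
    second constructor vacuously. *)
Inductive all_runs_reach nu : {ffun P -> nat} -> Prop :=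
  | AllRunsReached : terminal N nu -> all_runs_reach nu nu
  | AllRunsStep mu : ~~ terminal N mu ->
      (forall mu', sstep N mu mu' -> all_runs_reach nu mu') ->
      all_runs_reach nu mu.

(** Here [t] only witnesses that [mu] is not terminal; the nondeterministic choice is [u]. *)
Lemma all_runs_reach_step nu mu t : firable N mu t ->
  (forall u, firable N mu u ->
     (forall v, fire_mult N mu v <= fire_mult N mu u) ->
     all_runs_reach nu (fire N mu u)) ->
  all_runs_reach nu mu.
Proof.
move=> ft reach; apply: AllRunsStep => [|mu' /sstepP[u [fu max_u ->]]].
  by apply/forallPn; exists t; rewrite negbK.
exact: reach.
Qed.

Lemma all_runs_reach_finite nu mu (r : nat -> {ffun P -> nat}) :
  all_runs_reach nu mu -> r 0 = mu -> ~ forall n, sstep N (r n) (r n.+1).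
Proof.
move=> reach; elim: reach r => [tm|{}mu _ _ IH] r r0 rS.
  by move: (terminal_sstep (r 1) tm); rewrite -r0 rS.
by apply: (IH (r 1) _ (fun n => r n.+1)) => //; rewrite -r0.
Qed.

Lemma all_runs_reach_last nu mu s :
  all_runs_reach nu mu -> path (sstep N) mu s ->
  (forall mu', ~~ sstep N (last mu s) mu') -> last mu s = nu.
Proof.
move=> reach; elim: reach s => [tm|{}mu ntm _ IH] [|mu' s] //=.
- by rewrite (negbTE (terminal_sstep mu' tm)).
- by move=> _ /stuck_terminal; rewrite (negbTE ntm).
- by move=> /andP[/IH]; apply.
Qed.

Lemma all_runs_reach_init nu : all_runs_reach nu (init N) ->
  every_run_terminates N /\ forall s, maximal_run N s -> final_marking N s = nu.
Proof.
move=> reach; split=> [|s []]; last exact: all_runs_reach_last.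
split=> [[r [r0 rS]]|s [_ /stuck_terminal] //].
exact: all_runs_reach_finite reach r0 rS.
Qed.

End Runs.

(** Two naturals with the same lower bounds are equal, so [leq_fire_mult] reduces the closed forms
    to linear arithmetic. *)
Lemma zc_fire_mult x mu t : fire_mult (zero_check x) mu t =
  match t with
  | t1 => mu p1
  | t2 => minn (mu p4) (mu p5)
  | t3 => minn (mu p4) (minn (mu p5) (mu p8))
  | t4 => mu p6 %/ 2
  | t5 => minn (mu p5) (mu p6)
  | t6 => minn (mu p5) (mu p7)
  end.
Proof.
have leq_ext m n : (forall k, (k <= m) = (k <= n)) -> m = n.
  by move=> eq_mn; apply/eqP; rewrite eqn_leq -eq_mn leqnn eq_mn leqnn.
apply: leq_ext => k; rewrite leq_fire_mult; last first.
  by case: t; [exists p1|exists p4|exists p4|exists p6|exists p5|exists p5].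
apply/forallP/idP => [le_k|le_k p].
  (* These are all the input places; [p2] and [p3] feed no transition. *)
  move: (le_k p1) (le_k p4) (le_k p5) (le_k p6) (le_k p7) (le_k p8).
  by case: t {le_k} => /=; lia.
by case: t le_k; case: p => /=; lia.
Qed.

Lemma zc_terminal x q y : q \in [:: p2; p3] ->
  terminal (zero_check x) (zc_marking q y).
Proof.
rewrite !inE => /pred2P[]->; apply/forallP => t;
  by rewrite /firable zc_fire_mult; case: t; rewrite !ffunE //= !minn0.
Qed.

Definition mk8 a b c d e f g h : {ffun place -> nat} :=
  [ffun p => match p with p1 => a | p2 => b | p3 => c | p4 => d
                        | p5 => e | p6 => f | p7 => g | p8 => h end].

Lemma all_runs_reach_p5 x nu :
  all_runs_reach (zero_check x) nu (mk8 0 0 0 x 2 0 0 1) ->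
  all_runs_reach (zero_check x) nu (zc_marking p1 x).
Proof.
move=> reach; apply: (@all_runs_reach_step _ _ _ _ _ t1) => [|u].
  by rewrite /firable zc_fire_mult ffunE.
(* With [p5] and [p6] empty, only [t1] is firable. *)
rewrite /firable zc_fire_mult; case: u; rewrite !ffunE /= ?minn0 // => _ _.
rewrite (@fire_eq _ _ _ _ _ 1 (mk8 0 0 0 x 2 0 0 1)) ?zc_fire_mult ?ffunE //.
by case; rewrite !ffunE /=; lia.
Qed.

Lemma all_runs_reach_p2 x : 1 < x ->
  all_runs_reach (zero_check x) (zc_marking p2 x) (zc_marking p1 x).
Proof.
move=> x_gt1; apply: all_runs_reach_p5.
apply: (@all_runs_reach_step _ _ _ _ _ t2) => [|u fu /(_ t2)].
  by rewrite /firable zc_fire_mult !ffunE; lia.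
(* Comparison with [t2], of multiplicity [minn x 2 = 2], rules out [t3], of multiplicity 1. *)
move: fu; rewrite /firable !zc_fire_mult; case: u; rewrite !ffunE //=; try lia.
move=> _ _; rewrite (@fire_eq _ _ _ _ _ 2 (mk8 0 0 0 (x - 2) 0 2 0 1)); first last.
- by case; rewrite !ffunE /=; lia.
- by rewrite zc_fire_mult !ffunE; lia.
apply: (@all_runs_reach_step _ _ _ _ _ t4) => [|u].
  by rewrite /firable zc_fire_mult !ffunE.
rewrite /firable zc_fire_mult; case: u; rewrite !ffunE //= ?minn0 // => _ _.
(* The truncated [x - 2] regains its two tokens exactly because [1 < x]. *)
rewrite (@fire_eq _ _ _ _ _ 1 (zc_marking p2 x)); first last.
- by case; rewrite !ffunE /=; lia.
- by rewrite zc_fire_mult !ffunE.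
by constructor; apply: zc_terminal.
Qed.

Lemma all_runs_reach_p3 :
  all_runs_reach (zero_check 1) (zc_marking p3 1) (zc_marking p1 1).
Proof.
apply: all_runs_reach_p5.
apply: (@all_runs_reach_step _ _ _ _ _ t2) => [|u]; first by rewrite /firable zc_fire_mult !ffunE.
(* Two goals survive, for the tied choices [t2] and [t3]. *)
rewrite /firable zc_fire_mult; case: u; rewrite !ffunE //= => _ _.
- rewrite (@fire_eq _ _ _ _ _ 1 (mk8 0 0 0 0 1 1 0 1)); first last.
  + by case; rewrite !ffunE.
  + by rewrite zc_fire_mult !ffunE.
  apply: (@all_runs_reach_step _ _ _ _ _ t5) => [|u]; first by rewrite /firable zc_fire_mult !ffunE.
  (* A single token in [p6] gives [t4] multiplicity [1 %/ 2 = 0], so [t5] is the only choice. *)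
  rewrite /firable zc_fire_mult; case: u; rewrite !ffunE //= => _ _.
  rewrite (@fire_eq _ _ _ _ _ 1 (zc_marking p3 1)); first last.
  + by case; rewrite !ffunE.
  + by rewrite zc_fire_mult !ffunE.
  by constructor; apply: zc_terminal.
- rewrite (@fire_eq _ _ _ _ _ 1 (mk8 0 0 0 0 1 0 1 1)); first last.
  + by case; rewrite !ffunE.
  + by rewrite zc_fire_mult !ffunE.
  apply: (@all_runs_reach_step _ _ _ _ _ t6) => [|u]; first by rewrite /firable zc_fire_mult !ffunE.
  rewrite /firable zc_fire_mult; case: u; rewrite !ffunE //= => _ _.
  rewrite (@fire_eq _ _ _ _ _ 1 (zc_marking p3 1)); first last.
  + by case; rewrite !ffunE.
  + by rewrite zc_fire_mult !ffunE.
  by constructor; apply: zc_terminal.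
Qed.

Theorem theorem1 :
  (forall x : nat, 1 <= x ->
     every_run_terminates (zero_check x) /\
     forall s : seq {ffun place -> nat}, maximal_run (zero_check x) s ->
       (1 < x -> final_marking (zero_check x) s = zc_marking p2 x) /\
       (x = 1 -> final_marking (zero_check x) s = zc_marking p3 x)) /\
  (forall v : nat,
     every_run_terminates (zero_check v.+1) /\
     forall s : seq {ffun place -> nat}, maximal_run (zero_check v.+1) s ->
       [/\ final_marking (zero_check v.+1) s p3 = (if v == 0 then 1 else 0),
           final_marking (zero_check v.+1) s p2 = (if 0 < v then 1 else 0)
         & final_marking (zero_check v.+1) s p4 = v.+1]).
Proof.
(* One statement serves both halves of the claim; the register form is the case [x = v.+1]. *)
have runs x : 0 < x ->
    every_run_terminates (zero_check x) /\
    forall s, maximal_run (zero_check x) s ->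
      final_marking (zero_check x) s = zc_marking (if 1 < x then p2 else p3) x.
  move=> x_gt0; apply: all_runs_reach_init; case: ltnP => [|x_le1].
    exact: all_runs_reach_p2.
  have -> : x = 1 by lia.
  exact: all_runs_reach_p3.
split=> [x /runs|v]; [case=> term fin|case: (runs v.+1 isT) => term fin];
  split=> // s /fin ->; first by split=> [->|->].
by case: v {term fin} => [|v]; rewrite !ffunE.
Qed.
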